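(* Let $A\in\mathbb{C}^{n\times n}$ be normal, let $\lambda$ be a simple eigenvalue of $A$ with unit eigenvector $x_R$, and let $\operatorname{gap}_\lambda=\min_{\sigma\in\lambda(A),\,\sigma\ne\lambda}|\sigma-\lambda|$. Fix $\epsilon\in(0,1)$, $\beta>0$ and put $K_\epsilon=\frac{1+\epsilon}{1-\epsilon}$, $C_{RR}=\sqrt{1+K_\epsilon\|A-\lambda I\|^2/\beta^2}$. Consider the randomized Jacobi-Davidson iteration (without restarting) described in the context, with shift $\sigma_m\neq\lambda$ at each step, and suppose that the randomized correction equation is solved exactly at each step, that $S$ is an $\epsilon$-subspace embedding for $\operatorname{span}([V_m,AV_m])$ at each step, and that the sketched uniform separation condition holds with constant $\beta$. Let $\rho_m=\sin\angle(x_R,V_m)$ and $s_m=\sin\angle(x_R,u_m)$. (a) If the shift is the sketched Ritz value, $\sigma_m=\theta_m$, then for all sufficiently small $\rho_m$ (and $s_m$) $$\rho_{m+1}\le\frac{4\|A-\lambda I\|C_{RR}^2}{(1-\epsilon)\operatorname{gap}_\lambda}\bigl(\epsilon\rho_m^2+C_{RR}\rho_m^3\bigr),\qquad s_{m+1}\le\frac{4\|A-\lambda I\|C_{RR}}{(1-\epsilon)\operatorname{gap}_\lambda}\bigl(\epsilon s_m^2+s_m^3\bigr).$$ (b) If the shift used in the residual and in the correction equation is the standard Rayleigh quotient of the sketched Ritz vector, $\sigma_m=\widetilde\theta_m=\frac{u_m^*Au_m}{u_m^*u_m}$, then the convergence is locally cubic: for all sufficiently small $\rho_m$ (and $s_m$)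 $$\rho_{m+1}\le\frac{4\|A-\lambda I\|C_{RR}^3}{\operatorname{gap}_\lambda}\rho_m^3,\qquad s_{m+1}\le\frac{4\|A-\lambda I\|C_{RR}}{\operatorname{gap}_\lambda}s_m^3.$$
   Context: Notation: $\|\cdot\|$ is the Euclidean norm of vectors and the spectral norm of matrices; $\lambda(A)$ is the spectrum of $A$; $\operatorname{span}(V)$ is the column space of $V$. For nonzero $x$ and a matrix (or nonzero vector) $W$, $\sin\angle(x,W)=\min_{w\in\operatorname{span}(W)}\|x-w\|/\|x\|$. ''Sufficiently small'' means smaller than a positive threshold depending only on $A,\lambda,\epsilon,\beta$. Sketching: $S\in\mathbb{C}^{s\times n}$ is an $\epsilon$-subspace embedding for a subspace $\mathcal V\subset\mathbb{C}^n$ if $(1-\epsilon)\|u\|^2\le\|Su\|^2\le(1+\epsilon)\|u\|^2$ for all $u\in\mathcal V$. $V$ is sketch-orthonormal if $(SV)^*(SV)=I$. $x\perp_S y$ means $(Sx)^*(Sy)=0$. Iteration: $S$ is fixed and $V_0$ is sketch-orthonormal. At step $m\ge0$, given the sketch-orthonormal $V_m$, put $H_m=(SV_m)^*(SAV_m)$; select an eigenpair $(\theta_m,y_m)$ of $H_m$ with $\|y_m\|=1$ to target $(\lambda,x_R)$; set $u_m=V_my_m$ (so $\|Su_m\|=1$). Given the shift $\sigma_m\in\mathbb{C}$, set $r_m=Au_m-\sigma_mu_m$ and $\Pi_{u_m}^S=I-u_m(Su_m)^*S$, and solve the randomized correction equation $$\Pi_{u_m}^S(A-\sigma_mI)\Pi_{u_m}^S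 t_m=-\Pi_{u_m}^S r_m,\qquad t_m\perp_S u_m,$$ for $t_m$; then let $V_{m+1}$ be a sketch-orthonormal basis of $\operatorname{span}([V_m,t_m])$, extending $V_m$. Uniform separation condition with constant $\beta>0$: for every $m$, extending $y_m$ to a unitary matrix $[y_m,Y_\perp]$ and writing $[y_m,Y_\perp]^*H_m[y_m,Y_\perp]=\begin{bmatrix}\theta_m&H_{12}\\0&H_{22}\end{bmatrix}$, one has $\sigma_{\min}(H_{22}-\lambda I)\ge\beta$. *)

(* Defs.v *)
(* Complex numbers are R[i] for an arbitrary R : realType (MathComp and
   MathComp-Analysis); norms, sines, gaps and singular values lie in R.
   Vectors of C^n are columns. *)
From mathcomp Require Import all_boot all_order all_algebra.
From mathcomp Require Export complex.
From mathcomp Require Import all_classical all_reals ereal.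

Set Implicit Arguments.
Unset Strict Implicit.
Unset Printing Implicit Defensive.

Import Order.TTheory GRing.Theory Num.Theory.
Import ComplexField.Normc.

Local Open Scope classical_set_scope.
Local Open Scope ring_scope.
Local Open Scope sesquilinear_scope.
Local Open Scope complex_scope.

Section Norms.
Variable R : realType.

Definition vnorm n (v : 'cV[R[i]]_n) : R :=
  Num.sqrt (\sum_(i < n) normc (v i 0) ^+ 2).

(* The norm on matrices provided by MathComp-Analysis is the max norm, so the
   spectral norm is defined here as the operator norm induced by vnorm. *)
Definition specnorm m n (M : 'M[R[i]]_(m, n)) : R :=
  sup [set vnorm (M *m v) | v in [set v : 'cV[R[i]]_n | vnorm v <= 1]].

(* For square matrices. *)
Definition singular_values n (M : 'M[R[i]]_n) : set R :=
  [set s | 0 <= s /\ eigenvalue (M^t* *m M) (s%:C ^+ 2)].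

(* Extended-real valued so that the empty matrix has sigma_min = +oo: a lower
   bound on sigma_min is then void in dimension 0. *)
Definition sigma_min n (M : 'M[R[i]]_n) : \bar R :=
  ereal_inf [set s%:E | s in singular_values M].

Definition colspan n k (W : 'M[R[i]]_(n, k)) : set 'cV[R[i]]_n :=
  range (fun c : 'cV[R[i]]_k => W *m c).

Definition sinangle n k (x : 'cV[R[i]]_n) (W : 'M[R[i]]_(n, k)) : R :=
  inf [set vnorm (x - w) / vnorm x | w in colspan W].

(* [eigenvalue] speaks of left eigenvectors, which gives the same spectrum.
   The infimum is a minimum, as the spectrum is finite; if there is no
   eigenvalue other than lam the value is the junk value inf set0 = 0. *)
Definition gap n (A : 'M[R[i]]_n) (lam : R[i]) : R :=
  inf [set normc (s - lam)
        | s in [set s : R[i] | eigenvalue A s /\ s <> lam]].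

Definition simple_eigenvalue n (A : 'M[R[i]]_n) (lam : R[i]) : Prop :=
  mup lam (char_poly A) = 1%N.

End Norms.

Section Sketching.
Variables (R : realType) (n s : nat).
Implicit Types (S : 'M[R[i]]_(s, n)) (A : 'M[R[i]]_n).

Definition subspace_embedding (eps : R) S (U : set 'cV[R[i]]_n) : Prop :=
  forall u, U u ->
    (1 - eps) * vnorm u ^+ 2 <= vnorm (S *m u) ^+ 2 /\
    vnorm (S *m u) ^+ 2 <= (1 + eps) * vnorm u ^+ 2.

Definition sketch_orthonormal S k (V : 'M[R[i]]_(n, k)) : Prop :=
  (S *m V)^t* *m (S *m V) = 1%:M.

Definition sketch_orthogonal S (x y : 'cV[R[i]]_n) : Prop :=
  (S *m x)^t* *m (S *m y) = 0.

Definition sketched_proj S A k (V : 'M[R[i]]_(n, k)) : 'M[R[i]]_k :=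
  (S *m V)^t* *m (S *m A *m V).

Definition PiS S (u : 'cV[R[i]]_n) : 'M[R[i]]_n :=
  1%:M - u *m (S *m u)^t* *m S.

Definition residual A (sigma : R[i]) (u : 'cV[R[i]]_n) : 'cV[R[i]]_n :=
  A *m u - sigma *: u.

Definition correction_equation S A (sigma : R[i]) (u t : 'cV[R[i]]_n) : Prop :=
  PiS S u *m (A - sigma%:M) *m PiS S u *m t = - (PiS S u *m residual A sigma u)
  /\ sketch_orthogonal S t u.

Definition expands S k (V : 'M[R[i]]_(n, k)) (t : 'cV[R[i]]_n)
    k' (V' : 'M[R[i]]_(n, k')) : Prop :=
  [/\ sketch_orthonormal S V',
      colspan V' = colspan (row_mx V t),
      (k <= k')%N
    & forall (i : 'I_k) (j : 'I_k'), i = j :> nat -> col j V' = col i V].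

(* A run of N correction steps: the bases V m and the selected sketched Ritz
   pairs (theta m, y m) are constrained for m <= N, the shifts sigma m and the
   corrections t m for m < N; all other values are irrelevant. Runs are finite
   on purpose: with sigma m the sketched Ritz value or the Rayleigh quotient,
   exact solves and separation, a run that has become accurate enlarges its
   basis at every step until the Ritz vector is an exact eigenvector, and then
   sigma m = lam; so no such run goes on forever with sigma m <> lam. *)
Record rjd_run S A (lam : R[i]) (N : nat) (k : nat -> nat)
    (V : forall m, 'M[R[i]]_(n, k m)) (y : forall m, 'cV[R[i]]_(k m))
    (theta sigma : nat -> R[i]) (t : nat -> 'cV[R[i]]_n) : Prop := RjdRun {
  rjd_init : sketch_orthonormal S (V 0%N);
  rjd_ritz : forall m, (m <= N)%N ->
    sketched_proj S A (V m) *m y m = theta m *: y m;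
  rjd_unit : forall m, (m <= N)%N -> vnorm (y m) = 1;
  rjd_shift : forall m, (m < N)%N -> sigma m <> lam;
  rjd_solve : forall m, (m < N)%N ->
    correction_equation S A (sigma m) (V m *m y m) (t m);
  rjd_expand : forall m, (m < N)%N -> expands S (V m) (t m) (V m.+1)
}.

End Sketching.

Section Separation.
Variable R : realType.

(* Since y is a unit vector, k > 0 and [y, Y] is a square matrix, although its
   type 'M_(k, 1 + k.-1) does not show it; unitarymx then means unitary. *)
Definition separated k (H : 'M[R[i]]_k) (theta : R[i]) (y : 'cV[R[i]]_k)
    (lam : R[i]) (beta : R) : Prop :=
  forall (Y : 'M[R[i]]_(k, k.-1)) (H12 : 'rV[R[i]]_k.-1) (H22 : 'M[R[i]]_k.-1),
    row_mx y Y \is unitarymx ->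
    (row_mx y Y)^t* *m H *m row_mx y Y = block_mx theta%:M H12 0 H22 ->
    (beta%:E <= sigma_min (H22 - lam%:M))%E.

Definition rayleigh n (A : 'M[R[i]]_n) (u : 'cV[R[i]]_n) : R[i] :=
  (u^t* *m A *m u) 0 0 / (u^t* *m u) 0 0.

Definition Keps (eps : R) : R := (1 + eps) / (1 - eps).

Definition CRR n (A : 'M[R[i]]_n) (lam : R[i]) (eps beta : R) : R :=
  Num.sqrt (1 + Keps eps * specnorm (A - lam%:M) ^+ 2 / beta ^+ 2).

End Separation.

(* Main.v *)
(* Write B = A - lam I and u = V y. Solving the correction equation exactly gives
   (A - sigma I)(u + t) = gamma u, so the enlarged space contains the inverse
   iterate v = (A - sigma I)^-1 u (up to scaling). As A is normal, x and its
   orthogonal complement are both invariant, and splitting u and v along them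
   yields tan(x, v) <= |sigma - lam| tan(x, u) / (gap - |sigma - lam|).
   The order of convergence is thus that of the shift. Since B annihilates x and
   its range is orthogonal to x, u^* B u only sees the component of u orthogonal
   to x: the Rayleigh quotient has error |B| sin^2(x, u). The sketched Ritz value
   is (Su)^*(SAu) with |Su| = 1; the embedding perturbs the inner product of u
   and Bu by at most eps |u| |Bu|, which contributes a term linear in sin(x, u).
   Finally the separation condition gives sin(x, u) <= C_RR sin(x, V), which is
   used both before and after the step. *)
Require Import Defs.
From mathcomp Require Import all_boot all_order all_algebra.
From mathcomp Require Import all_classical all_reals.
From mathcomp Require Import ring lra.
From mathcomp Require ereal.

Set Implicit Arguments.
Unset Strict Implicit.
Unset Printing Implicit Defensive.

Import Order.TTheory GRing.Theory Num.Theory.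
Import ComplexField.Normc.

Local Open Scope classical_set_scope.
Local Open Scope complex_scope.
Local Open Scope ring_scope.
Local Open Scope sesquilinear_scope.

(** * The Hermitian product and the norms *)

Section HermitianProduct.
Variable R : realType.
Local Notation C := R[i].

Lemma normcE_norm (z : C) : `|z| = (normc z)%:C.
Proof. by []. Qed.

Lemma normc_ge0 (z : C) : 0 <= normc z.
Proof. by case: z => a b; exact: sqrtr_ge0. Qed.

Lemma normc_real (a : R) : 0 <= a -> normc a%:C = a.
Proof. by move=> a0; rewrite /= expr0n /= addr0 sqrtr_sqr ger0_norm. Qed.

Lemma normc_gt0 (z : C) : (0 < normc z) = (z != 0).
Proof. by rewrite -ltcR -normcE_norm normr_gt0. Qed.

Lemma normc_sqr (z : C) : z^* * z = (normc z ^+ 2)%:C :> C.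
Proof. by rewrite mulrC -normCK normcE_norm rmorphXn. Qed.

Lemma realcM (a b : R) : (a * b)%:C = a%:C * b%:C :> C.
Proof. exact: rmorphM. Qed.

Lemma conjC_realc (a : R) : (a%:C : C)^* = a%:C.
Proof. by apply/CrealP; rewrite complex_real. Qed.

Lemma normc_subC (z w : C) : normc (z - w) = normc (w - z).
Proof. by rewrite -normcN opprB. Qed.

Definition dotc n (x y : 'cV[C]_n) : C := (x^t* *m y) 0 0.

Lemma dotcE n (x y : 'cV[C]_n) : dotc x y = \sum_i (x i 0)^* * y i 0.
Proof. by rewrite /dotc mxE; apply: eq_bigr => i _; rewrite !mxE. Qed.

Lemma mx11_dotc n (x y : 'cV[C]_n) : x^t* *m y = (dotc x y)%:M.
Proof. by rewrite [LHS]mx11_scalar. Qed.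

Lemma trmxCD m n (M N : 'M[C]_(m, n)) : (M + N)^t* = M^t* + N^t*.
Proof. by rewrite linearD map_mxD. Qed.

Lemma trmxCM m n p (M : 'M[C]_(m, n)) (N : 'M[C]_(n, p)) :
  (M *m N)^t* = N^t* *m M^t*.
Proof. by rewrite trmx_mul map_mxM. Qed.

Lemma trmxCZ m n (a : C) (M : 'M[C]_(m, n)) : (a *: M)^t* = a^* *: M^t*.
Proof. by rewrite linearZ map_mxZ. Qed.

Lemma dotcDr n (x y z : 'cV[C]_n) : dotc x (y + z) = dotc x y + dotc x z.
Proof. by rewrite /dotc mulmxDr mxE. Qed.

Lemma dotcZr n (a : C) (x y : 'cV[C]_n) : dotc x (a *: y) = a * dotc x y.
Proof. by rewrite /dotc -scalemxAr mxE. Qed.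

Lemma dotcDl n (x y z : 'cV[C]_n) : dotc (x + y) z = dotc x z + dotc y z.
Proof. by rewrite /dotc trmxCD mulmxDl mxE. Qed.

Lemma dotcZl n (a : C) (x y : 'cV[C]_n) : dotc (a *: x) y = a^* * dotc x y.
Proof. by rewrite /dotc trmxCZ -scalemxAl mxE. Qed.

Lemma dotcNr n (x y : 'cV[C]_n) : dotc x (- y) = - dotc x y.
Proof. by rewrite -scaleN1r dotcZr mulN1r. Qed.

Lemma dotcNl n (x y : 'cV[C]_n) : dotc (- x) y = - dotc x y.
Proof. by rewrite -scaleN1r dotcZl rmorphN1 mulN1r. Qed.

Lemma dotcBr n (x y z : 'cV[C]_n) : dotc x (y - z) = dotc x y - dotc x z.
Proof. by rewrite dotcDr dotcNr. Qed.

Lemma dotcC n (x y : 'cV[C]_n) : dotc y x = (dotc x y)^*.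
Proof.
rewrite !dotcE rmorph_sum; apply: eq_bigr => i _.
by rewrite rmorphM /= conjCK mulrC.
Qed.

Lemma dotc0r n (x : 'cV[C]_n) : dotc x 0 = 0.
Proof. by rewrite /dotc mulmx0 mxE. Qed.

Lemma dotc0l n (x : 'cV[C]_n) : dotc 0 x = 0.
Proof. by rewrite dotcC dotc0r rmorph0. Qed.

Lemma dotc_mulmx m n (M : 'M[C]_(m, n)) (x : 'cV[C]_n) (y : 'cV[C]_m) :
  dotc (M *m x) y = dotc x (M^t* *m y).
Proof. by rewrite /dotc trmxCM mulmxA. Qed.

Lemma vnorm_ge0 n (v : 'cV[C]_n) : 0 <= vnorm v.
Proof. exact: sqrtr_ge0. Qed.

Lemma vnorm_sqr n (v : 'cV[C]_n) : vnorm v ^+ 2 = \sum_i normc (v i 0) ^+ 2.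
Proof. by rewrite sqr_sqrtr // sumr_ge0 // => i _; exact: sqr_ge0. Qed.

Lemma dotcc n (v : 'cV[C]_n) : dotc v v = (vnorm v ^+ 2)%:C.
Proof.
rewrite vnorm_sqr dotcE rmorph_sum; apply: eq_bigr => i _.
exact: normc_sqr.
Qed.

Lemma vnorm_eq0 n (v : 'cV[C]_n) : (vnorm v == 0) = (v == 0).
Proof.
apply/eqP/eqP => [v0|->]; last first.
  rewrite /vnorm big1 ?sqrtr0 // => i _.
  by rewrite mxE normc0 expr0n.
apply/colP => i; rewrite mxE; apply/eq0_normc/eqP; rewrite -sqrf_eq0.
have := vnorm_sqr v; rewrite v0 expr0n /= => /esym/eqP.
rewrite psumr_eq0; last by move=> j _; exact: sqr_ge0.
by move=> /allP/(_ i); rewrite mem_index_enum => /(_ isT).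
Qed.

Lemma vnorm_gt0 n (v : 'cV[C]_n) : (0 < vnorm v) = (v != 0).
Proof. by rewrite lt_neqAle vnorm_ge0 andbT eq_sym vnorm_eq0. Qed.

Lemma dotcc_eq0 n (v : 'cV[C]_n) : (dotc v v == 0) = (v == 0).
Proof.
rewrite dotcc -vnorm_eq0 -(sqrf_eq0 (vnorm v)).
by rewrite -(inj_eq (@complexI R)).
Qed.

Lemma vnormZ n (a : C) (v : 'cV[C]_n) : vnorm (a *: v) = normc a * vnorm v.
Proof.
apply/eqP; rewrite -(@eqrXn2 _ 2) ?mulr_ge0 ?vnorm_ge0 ?normc_ge0 //.
apply/eqP; apply: complexI.
rewrite -dotcc dotcZl dotcZr mulrA normc_sqr dotcc.
by rewrite -realcM exprMn.
Qed.

Lemma vnormD_ortho n (x y : 'cV[C]_n) : dotc x y = 0 ->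
  vnorm (x + y) ^+ 2 = vnorm x ^+ 2 + vnorm y ^+ 2.
Proof.
move=> xy0; apply: complexI; rewrite rmorphD /= -!dotcc.
by rewrite dotcDl !dotcDr (dotcC x y) xy0 rmorph0 addr0 add0r.
Qed.

Lemma vnorm_le n m (x : 'cV[C]_n) (y : 'cV[C]_m) :
  (vnorm x <= vnorm y) = (vnorm x ^+ 2 <= vnorm y ^+ 2).
Proof. by rewrite ler_sqr ?nnegrE ?vnorm_ge0. Qed.

Lemma dotc_proj n (x y : 'cV[C]_n) : y != 0 ->
  dotc y (x - (dotc y x / dotc y y) *: y) = 0.
Proof.
by move=> y0; rewrite dotcBr dotcZr divfK ?subrr // dotcc_eq0.
Qed.

(** Cauchy-Schwarz. [y] is the sum of [c *: x] and a vector orthogonal to [x], so Pythagoras gives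
    |c x| <= |y|, while |dotc x y| = |c x| |x|. *)
Lemma dotc_le n (x y : 'cV[C]_n) : normc (dotc x y) <= vnorm x * vnorm y.
Proof.
have [->|x0] := eqVneq x 0.
  by rewrite dotc0l normc0 mulr_ge0 ?vnorm_ge0.
have px : 0 < vnorm x by rewrite vnorm_gt0.
set c := dotc x y / dotc x x.
have dE : dotc x y = c * dotc x x by rewrite divfK // dotcc_eq0.
have := vnormD_ortho (x := c *: x) (y := y - c *: x).
rewrite dotcZl dotc_proj // mulr0 addrC subrK => /(_ erefl) yE.
rewrite dE normcM dotcc normc_real ?sqr_ge0 // expr2 mulrA.
rewrite [X in _ <= X]mulrC ler_pM2r // -vnormZ vnorm_le yE lerDl.
exact: sqr_ge0.
Qed.

Lemma vnormD_le n (x y : 'cV[C]_n) : vnorm (x + y) <= vnorm x + vnorm y.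
Proof.
rewrite -ler_sqr ?nnegrE ?addr_ge0 ?vnorm_ge0 // -lecR -dotcc.
have -> : ((vnorm x + vnorm y) ^+ 2)%:C
  = dotc x x + dotc y y + (vnorm x * vnorm y *+ 2)%:C :> C.
  by rewrite !dotcc -!rmorphD /=; congr (_%:C); ring.
have -> : dotc (x + y) (x + y)
  = dotc x x + dotc y y + (dotc x y + (dotc x y)^*).
  rewrite dotcDl !dotcDr (dotcC x y); ring.
rewrite lerD2l; set z := dotc x y; have zr : z + z^* \is Num.real.
  by apply/CrealP; rewrite rmorphD /= conjCK addrC.
apply: le_trans (real_ler_norm zr) _.
apply: le_trans (ler_normD _ _) _; rewrite norm_conjC -mulr2n.
by rewrite normcE_norm -rmorphMn lecR ler_wMn2r // dotc_le.
Qed.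

Lemma vnorm_isometry m n (U : 'M[C]_(m, n)) (x : 'cV[C]_n) :
  U^t* *m U = 1%:M -> vnorm (U *m x) = vnorm x.
Proof.
move=> UU; apply/eqP; rewrite -(@eqrXn2 _ 2) ?vnorm_ge0 //.
apply/eqP; apply: complexI; rewrite -!dotcc dotc_mulmx mulmxA UU mul1mx //.
Qed.

(** Cauchy-Schwarz on each row gives the Frobenius norm as constant. A bound is required because the
    supremum in [specnorm] is meaningful only over a set that is bounded above. *)
Lemma vnorm_mulmx_bounded m n (M : 'M[C]_(m, n)) :
  exists K : R, forall v, vnorm (M *m v) <= K * vnorm v.
Proof.
exists (Num.sqrt (\sum_i vnorm ((row i M)^t*) ^+ 2)) => v.
have K0 : 0 <= \sum_i vnorm ((row i M)^t*) ^+ 2.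
  by apply: sumr_ge0 => i _; exact: sqr_ge0.
rewrite -ler_sqr ?nnegrE ?mulr_ge0 ?sqrtr_ge0 ?vnorm_ge0 //.
rewrite exprMn (sqr_sqrtr K0) mulr_suml vnorm_sqr; apply: ler_sum => i _.
rewrite -exprMn ler_sqr ?nnegrE ?normc_ge0 ?mulr_ge0 ?vnorm_ge0 //.
suff -> : (M *m v) i 0 = dotc ((row i M)^t*) v by exact: dotc_le.
by rewrite /dotc trmxCK -row_mul [RHS]mxE.
Qed.

Lemma vnorm0 n : vnorm (0 : 'cV[C]_n) = 0.
Proof. by apply/eqP; rewrite vnorm_eq0. Qed.

Lemma specnorm_ub m n (M : 'M[C]_(m, n)) (v : 'cV[C]_n) :
  vnorm v <= 1 -> vnorm (M *m v) <= specnorm M.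
Proof.
move=> v1; apply: ub_le_sup; last by exists v.
have [K KP] := vnorm_mulmx_bounded M.
exists `|K| => _ [w /= w1 <-]; apply: le_trans (KP w) _.
apply: le_trans (ler_norm _) _; rewrite normrM ler_piMr //.
by rewrite ger0_norm ?vnorm_ge0.
Qed.

Lemma specnorm_ge0 m n (M : 'M[C]_(m, n)) : 0 <= specnorm M.
Proof. by have := @specnorm_ub _ _ M 0; rewrite mulmx0 !vnorm0; apply. Qed.

Lemma le_specnorm m n (M : 'M[C]_(m, n)) (v : 'cV[C]_n) :
  vnorm (M *m v) <= specnorm M * vnorm v.
Proof.
have [->|v0] := eqVneq v 0; first by rewrite mulmx0 !vnorm0 mulr0.
have pv : 0 < vnorm v by rewrite vnorm_gt0.
have vV : normc ((vnorm v)^-1)%:C = (vnorm v)^-1.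
  by rewrite normc_real // invr_ge0 ltW.
rewrite -ler_pdivrMr // mulrC -vV -vnormZ scalemxAr specnorm_ub //.
by rewrite vnormZ vV mulVf // gt_eqF.
Qed.

End HermitianProduct.

(** * Angles between a vector and a subspace *)

Section Sine.
Variable R : realType.
Local Notation C := R[i].

Lemma vnorm_reject n (x y : 'cV[C]_n) : y != 0 ->
  vnorm (x - (dotc y x / dotc y y) *: y) ^+ 2 * vnorm y ^+ 2
  = vnorm x ^+ 2 * vnorm y ^+ 2 - normc (dotc y x) ^+ 2.
Proof.
move=> y0; have yy0 : dotc y y != 0 by rewrite dotcc_eq0.
set c := dotc y x / dotc y y.
have := vnormD_ortho (x := c *: y) (y := x - c *: y).
rewrite dotcZl dotc_proj // mulr0 [c *: y + _]addrC subrK => /(_ erefl) ->.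
have -> : dotc y x = c * dotc y y by rewrite divfK.
rewrite normcM dotcc normc_real ?sqr_ge0 // vnormZ.
ring.
Qed.

Lemma sinangle_le n k (x : 'cV[C]_n) (W : 'M[C]_(n, k)) c :
  vnorm x = 1 -> sinangle x W <= vnorm (x - W *m c).
Proof.
move=> x1; apply: ge_inf.
  by exists 0 => _ [w _ <-]; rewrite divr_ge0 ?vnorm_ge0.
by exists (W *m c); [exists c | rewrite x1 divr1].
Qed.

Lemma sinangle_ge0 n k (x : 'cV[C]_n) (W : 'M[C]_(n, k)) : 0 <= sinangle x W.
Proof.
apply: lb_le_inf; last by move=> _ [w _ <-]; rewrite divr_ge0 ?vnorm_ge0.
by exists (vnorm (x - W *m 0) / vnorm x); exists (W *m 0) => //; exists 0.
Qed.

(** A solution of the normal equations attains the infimum: any other candidate differs from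
    [W *m c] by a vector of the column space, orthogonal to the residual, so Pythagoras can only add
    length. *)
Lemma sinangle_ortho n k (x : 'cV[C]_n) (W : 'M[C]_(n, k)) c :
  vnorm x = 1 -> W^t* *m (x - W *m c) = 0 ->
  sinangle x W = vnorm (x - W *m c).
Proof.
move=> x1 xW; apply: le_anti; rewrite sinangle_le //=; apply: lb_le_inf.
  by exists (vnorm (x - W *m 0) / vnorm x); exists (W *m 0) => //; exists 0.
move=> _ [_ [d _ <-] <-]; rewrite x1 divr1 vnorm_le.
have -> : x - W *m d = W *m (c - d) + (x - W *m c).
  by rewrite mulmxBr [RHS]addrC addrA subrK.
rewrite [leRHS]vnormD_ortho ?lerDr ?sqr_ge0 //.
by rewrite dotc_mulmx xW dotc0r.
Qed.

Lemma ortho_projection n k (x : 'cV[C]_n) (W : 'M[C]_(n, k)) :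
  W^t* *m W \in unitmx -> exists c, W^t* *m (x - W *m c) = 0.
Proof.
move=> WU; exists (invmx (W^t* *m W) *m (W^t* *m x)).
by rewrite mulmxBr mulmxA mulKVmx // subrr.
Qed.

Lemma sinangle_vectorE n (x u : 'cV[C]_n) : vnorm x = 1 -> u != 0 ->
  (sinangle x u * vnorm u) ^+ 2 = vnorm u ^+ 2 - normc (dotc x u) ^+ 2.
Proof.
move=> x1 u0; have uu0 : dotc u u != 0 by rewrite dotcc_eq0.
rewrite (@sinangle_ortho _ _ _ _ (dotc u x / dotc u u)%:M) //; last first.
  by rewrite mul_mx_scalar mx11_dotc dotc_proj // raddf0.
rewrite mul_mx_scalar exprMn vnorm_reject // x1 expr1n mul1r.
by congr (_ - _ ^+ 2); apply: complexI; rewrite -!normcE_norm dotcC norm_conjC.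
Qed.

(** The angle between two lines is symmetric. [sinangle] measures the unit vector [x] against the
    line of [u], whereas the later estimates split [u] along [x]. *)
Lemma sinangle_vector_reject n (x u : 'cV[C]_n) : vnorm x = 1 -> u != 0 ->
  vnorm (u - dotc x u *: x) = sinangle x u * vnorm u.
Proof.
move=> x1 u0; apply/eqP.
rewrite -(@eqrXn2 _ 2) ?mulr_ge0 ?sinangle_ge0 ?vnorm_ge0 //.
rewrite sinangle_vectorE //; apply/eqP.
have x0 : x != 0 by rewrite -vnorm_eq0 x1 oner_eq0.
have := vnorm_reject u x0.
by rewrite dotcc x1 !expr1n !mulr1 divr1.
Qed.

End Sine.

(** * Spectral decomposition and the smallest singular value *)

Section SingularValues.
Variable R : realType.
Local Notation C := R[i].

Lemma spectralE n (A : 'M[C]_n) : A \is normalmx ->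
  spectralmx A *m A = diag_mx (spectral_diag A) *m spectralmx A.
Proof.
move=> /orthomx_spectralP {2}->.
by rewrite !mulmxA mulmxV ?spectral_unit // mul1mx.
Qed.

Lemma spectralmx_isometry n (A : 'M[C]_n) :
  (spectralmx A)^t* *m spectralmx A = 1%:M.
Proof.
rewrite -invmx_unitary ?spectral_unitarymx // mulVmx //.
exact: spectral_unit.
Qed.

Lemma spectral_diag_eigen n (A : 'M[C]_n) i : A \is normalmx ->
  eigenvalue A (spectral_diag A 0 i).
Proof.
move=> An; apply/eigenvalueP; exists (row i (spectralmx A)).
  rewrite -row_mul spectralE //; apply/rowP => j.
  by rewrite mxE mul_diag_mx !mxE.
apply/negP => /eqP r0.
have /unitarymxP/(congr1 (row i)) := spectral_unitarymx A.
rewrite row_mul r0 mul0mx => /rowP/(_ i); rewrite !mxE eqxx => /eqP.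
by rewrite eq_sym oner_eq0.
Qed.

Lemma spectral_mul n (A : 'M[C]_n) (w : 'cV[C]_n) i : A \is normalmx ->
  (spectralmx A *m (A *m w)) i 0
  = spectral_diag A 0 i * (spectralmx A *m w) i 0.
Proof. by move=> An; rewrite mulmxA spectralE // -mulmxA mul_diag_mx mxE. Qed.

Lemma gram_normal m n (M : 'M[C]_(m, n)) : M^t* *m M \is normalmx.
Proof. by apply/normalmxP; rewrite trmxCM trmxCK. Qed.

Lemma dotc_col m n (N : 'M[C]_(m, n)) i :
  dotc (col i N) (col i N) = (N^t* *m N) i i.
Proof. by rewrite dotcE [RHS]mxE; apply: eq_bigr => j _; rewrite !mxE. Qed.

(** In an orthonormal eigenbasis of the Gram matrix [G], |M v|^2 is a sum of squared coordinates of
    [v] weighted by squared singular values, each at least [beta ^+ 2]. *)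
Lemma le_sigma_min n (M : 'M[C]_n) (beta : R) (v : 'cV[C]_n) :
  0 <= beta -> (beta%:E <= sigma_min M)%E ->
  beta * vnorm v <= vnorm (M *m v).
Proof.
move=> beta0 betaM; set G := M^t* *m M; set P := spectralmx G.
have Gn : G \is normalmx by exact: gram_normal.
have PP : P^t* *m P = 1%:M by exact: spectralmx_isometry.
(* [f i] is the length of the image under [M] of the i-th eigenvector of [G]; this exhibits the
   eigenvalue as the square of a nonnegative real, as [singular_values] demands. *)
pose f i := vnorm (col i (M *m P^t*)).
have fE i : spectral_diag G 0 i = (f i)%:C ^+ 2.
  rewrite -rmorphXn /= -dotcc dotc_col.
  rewrite trmxCM trmxCK mulmxA -(mulmxA P) spectralE // -mulmxA.
  by rewrite (unitarymxP _) ?spectral_unitarymx // mulmx1 mxE eqxx.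
have fbeta i : beta <= f i.
  rewrite -lee_fin; apply: le_trans betaM _; apply: ereal.ereal_inf_lbound.
  exists (f i) => //; split; first exact: vnorm_ge0.
  by rewrite -fE spectral_diag_eigen.
rewrite -ler_sqr ?nnegrE ?mulr_ge0 ?vnorm_ge0 // exprMn.
rewrite -(vnorm_isometry v PP) -lecR -dotcc dotc_mulmx mulmxA -/G.
rewrite -[G *m v]mul1mx -PP -mulmxA -dotc_mulmx dotcE.
rewrite vnorm_sqr mulr_sumr rmorph_sum; apply: ler_sum => i _.
rewrite spectral_mul // fE -/P.
have -> : ((P *m v) i 0)^* * ((f i)%:C ^+ 2 * (P *m v) i 0)
  = (f i ^+ 2 * normc ((P *m v) i 0) ^+ 2)%:C.
  by rewrite mulrCA normc_sqr -rmorphXn -realcM.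
rewrite lecR ler_wpM2r ?sqr_ge0 // ler_sqr ?nnegrE // ?vnorm_ge0 //.
Qed.

End SingularValues.

(** * The spectral gap of a normal matrix *)

Section Gap.
Variable R : realType.
Local Notation C := R[i].

Lemma char_poly_similar n (P A D : 'M[C]_n) : P \in unitmx ->
  P *m A = D *m P -> char_poly A = char_poly D.
Proof.
move=> Pu PA; have dP : \det (map_mx (@polyC C) P) != 0.
  by rewrite det_map_mx polyC_eq0 -unitfE.
apply: (mulfI dP); rewrite [RHS]mulrC /char_poly -!det_mulmx.
rewrite /char_poly_mx mulmxBr mulmxBl -!map_mxM PA; congr (\det (_ - _)).
by rewrite mul_mx_scalar mul_scalar_mx.
Qed.

Lemma char_poly_spectral n (A : 'M[C]_n) : A \is normalmx ->
  char_poly A = \prod_i ('X - (spectral_diag A 0 i)%:P).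
Proof.
move=> An; rewrite (char_poly_similar (spectral_unit A) (spectralE An)).
rewrite char_poly_trig ?diag_mx_is_trig //; apply: eq_bigr => i _.
by rewrite mxE eqxx.
Qed.

Lemma eigenvalue_spectral n (A : 'M[C]_n) (z : C) : A \is normalmx ->
  eigenvalue A z -> exists i, spectral_diag A 0 i = z.
Proof.
move=> An; rewrite eigenvalue_root_char char_poly_spectral // rootE.
rewrite horner_prod => /prodf_eq0 [i _].
by rewrite !hornerE subr_eq0 => /eqP ->; exists i.
Qed.

(** Two different diagonal positions holding [lam] would make the square of X - lam divide the
    characteristic polynomial. *)
Lemma simple_spectral_inj n (A : 'M[C]_n) (lam : C) i j : A \is normalmx ->
  simple_eigenvalue A lam ->
  spectral_diag A 0 i = lam -> spectral_diag A 0 j = lam -> i = j.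
Proof.
move=> An lam1 il jl; apply/eqP/negPn/negP => ij.
suff : (1 < mup lam (char_poly A))%N by rewrite lam1.
rewrite mup_geq ?monic_neq0 ?char_poly_monic // char_poly_spectral //.
rewrite (bigD1 i) //= (bigD1 j) ?(eq_sym j) //= il jl mulrA -expr2.
exact: dvdp_mulIl.
Qed.

Section Eigenvector.
Variables (n : nat) (A : 'M[C]_n) (lam : C) (x : 'cV[C]_n).
Hypotheses (A_normal : A \is normalmx) (Ax : A *m x = lam *: x).

Lemma eigenvector_spectral i : spectral_diag A 0 i != lam ->
  (spectralmx A *m x) i 0 = 0.
Proof.
move=> il; have := spectral_mul x i A_normal.
rewrite Ax -scalemxAr [in LHS]mxE => /eqP.
by rewrite -subr_eq0 -mulrBl mulf_eq0 subr_eq0 eq_sym (negPf il) => /eqP.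
Qed.

Lemma dotc_spectral (w z : 'cV[C]_n) :
  dotc w z = \sum_i ((spectralmx A *m w) i 0)^* * (spectralmx A *m z) i 0.
Proof. by rewrite -dotcE dotc_mulmx mulmxA spectralmx_isometry mul1mx. Qed.

(** Normality makes the right eigenvector [x] a left one as well: in the spectral basis, [x] is
    supported on the positions whose diagonal entry is [lam]. *)
Lemma eigenvector_dotc (w : 'cV[C]_n) : dotc x (A *m w) = lam * dotc x w.
Proof.
rewrite !dotc_spectral mulr_sumr; apply: eq_bigr => i _.
have [il|il] := eqVneq (spectral_diag A 0 i) lam.
  by rewrite spectral_mul // il mulrCA.
by rewrite eigenvector_spectral // rmorph0 !mul0r mulr0.
Qed.

Hypotheses (lam_simple : simple_eigenvalue A lam) (x0 : x != 0).

(** By simplicity [x] is supported on the single coordinate [i], so orthogonality to [x] forces that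
    coordinate of [w] to vanish. *)
Lemma ortho_spectral (w : 'cV[C]_n) i : dotc x w = 0 ->
  spectral_diag A 0 i = lam -> (spectralmx A *m w) i 0 = 0.
Proof.
move=> xw il.
have off j : j != i -> (spectralmx A *m x) j 0 = 0.
  move=> ji; apply: eigenvector_spectral; apply: contra_neq ji => jl.
  exact: simple_spectral_inj il.
have xi : (spectralmx A *m x) i 0 != 0.
  apply: contra_neq x0 => xi.
  have : spectralmx A *m x = 0.
    by apply/colP => j; rewrite [RHS]mxE; have [->|/off] := eqVneq j i.
  move=> /(congr1 (mulmx ((spectralmx A)^t*))).
  by rewrite mulmxA spectralmx_isometry mul1mx mulmx0.
move: xw; rewrite dotc_spectral (bigD1 i) //= big1 => [|j ji].
  by rewrite addr0 => /eqP; rewrite mulf_eq0 conjC_eq0 (negPf xi) => /eqP.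
by rewrite off // rmorph0 mul0r.
Qed.

(** Serves the degenerate case where [lam] is the whole spectrum: simplicity then leaves nothing
    orthogonal to [x]. *)
Lemma ortho_trivial (w : 'cV[C]_n) : (forall i, spectral_diag A 0 i = lam) ->
  dotc x w = 0 -> w = 0.
Proof.
move=> Dl xw; rewrite -[w]mul1mx -(spectralmx_isometry A) -mulmxA.
suff -> : spectralmx A *m w = 0 by rewrite mulmx0.
by apply/colP => i; rewrite [RHS]mxE ortho_spectral.
Qed.

Lemma gap_le (z : C) :
  eigenvalue A z -> z != lam -> gap A lam <= normc (z - lam).
Proof.
move=> Az zl; apply: ge_inf.
  by exists 0 => _ [s _ <-]; exact: normc_ge0.
by exists z => //; split => //; exact/eqP.
Qed.

Lemma gap_ge0 : 0 <= gap A lam.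
Proof.
have [[s sP]|E] := pselect (exists s, eigenvalue A s /\ s <> lam).
  apply: lb_le_inf => [|_ [z _ <-]]; last exact: normc_ge0.
  by exists (normc (s - lam)); exists s.
rewrite /gap (_ : [set s | eigenvalue A s /\ s <> lam] = set0).
  by rewrite image_set0 inf0.
by apply/seteqP; split => // s sP; apply: E; exists s.
Qed.

(** In spectral coordinates [A - lam%:M] multiplies each coordinate by an eigenvalue difference. The
    coordinate with difference 0 is absent from [w], and the other differences are at least the
    gap. *)
Lemma le_gap (w : 'cV[C]_n) : dotc x w = 0 ->
  gap A lam * vnorm w <= vnorm ((A - lam%:M) *m w).
Proof.
move=> xw; have iso := spectralmx_isometry A.
rewrite -(vnorm_isometry w iso) -(vnorm_isometry ((A - lam%:M) *m w) iso).
rewrite -ler_sqr ?nnegrE ?mulr_ge0 ?gap_ge0 ?vnorm_ge0 // exprMn !vnorm_sqr.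
rewrite mulr_sumr; apply: ler_sum => i _.
have -> : (spectralmx A *m ((A - lam%:M) *m w)) i 0
    = (spectral_diag A 0 i - lam) * (spectralmx A *m w) i 0.
  rewrite mulmxBl mulmxBr mul_scalar_mx -scalemxAr mulrBl -spectral_mul //.
  by rewrite [LHS]mxE [X in _ + X]mxE [X in _ - X]mxE.
have [il|il] := eqVneq (spectral_diag A 0 i) lam.
  by rewrite ortho_spectral // mulr0 normc0 expr0n mulr0.
rewrite normcM exprMn ler_wpM2r ?sqr_ge0 //.
rewrite ler_sqr ?nnegrE ?normc_ge0 ?gap_ge0 //.
by apply: gap_le => //; exact: spectral_diag_eigen.
Qed.

End Eigenvector.

(** The minimum over the finitely many diagonal entries different from [lam] is positive and bounds
    the infimum from below. *)
Lemma gap_gt0 n (A : 'M[C]_n) (lam : C) i : A \is normalmx ->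
  spectral_diag A 0 i != lam -> 0 < gap A lam.
Proof.
move=> An il; pose D := spectral_diag A 0.
case: (@arg_minP _ _ _ i (fun j => D j != lam) (fun j => normc (D j - lam)) il).
move=> j jl jmin; have j0 : 0 < normc (D j - lam) by rewrite normc_gt0 subr_eq0.
apply: lt_le_trans j0 _; apply: lb_le_inf => [|_ [z [Az zl] <-]].
  exists (normc (D j - lam)); exists (D j) => //; split; last exact/eqP.
  exact: spectral_diag_eigen.
have [l Dl] := eigenvalue_spectral An Az.
by rewrite -Dl jmin // /D Dl; exact/eqP.
Qed.

End Gap.

(** * One step of inverse iteration *)

Section InverseIteration.
Variable R : realType.
Local Notation C := R[i].

(** Compare the components of [v] along and across [x]: the first is gam a / (lam - sigma) exactly,
    the second is at most 2/g times |gam b|. Their ratio is the tangent, in which [gam] cancels. The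
    constant 4 collects two factors 2, one from the gap and one from |a|. *)
Lemma shifted_solve_sine n (A : 'M[C]_n) (lam sigma gam : C) (g : R)
    (x u v : 'cV[C]_n) :
  A \is normalmx -> A *m x = lam *: x -> vnorm x = 1 -> 0 < g ->
  (forall w, dotc x w = 0 -> g * vnorm w <= vnorm ((A - lam%:M) *m w)) ->
  u != 0 -> v != 0 -> sigma != lam -> (A - sigma%:M) *m v = gam *: u ->
  sinangle x u <= 2^-1 -> normc (sigma - lam) <= g / 2 ->
  exists c : C,
    vnorm (x - c *: v) <= 4 / g * normc (sigma - lam) * sinangle x u.
Proof.
move=> An Ax x1 g0 gw u0 v0 sl vu s2 d2.
set s := sinangle x u; set d := normc (sigma - lam).
have xx : dotc x x = 1 by rewrite dotcc x1 expr1n.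
pose a := dotc x u; pose b := u - a *: x.
pose a' := dotc x v; pose b' := v - a' *: x.
have xb' : dotc x b' = 0 by rewrite dotcBr dotcZr xx mulr1 subrr.
have coef : (lam - sigma) * a' = gam * a.
  rewrite /a -dotcZr -vu mulmxBl mul_scalar_mx dotcBr dotcZr.
  by rewrite (eigenvector_dotc An Ax) mulrBl.
have res : (A - lam%:M) *m b' = gam *: b + (sigma - lam) *: b'.
  have -> : gam *: b = (A - sigma%:M) *m v - (gam * a) *: x.
    by rewrite vu scalerBr scalerA.
  rewrite -coef /b' !mulmxBl !mulmxBr !mul_scalar_mx -!scalemxAr Ax.
  rewrite !scalerA; apply/colP => i; rewrite !mxE; ring.
have bnorm : vnorm b = s * vnorm u by exact: sinangle_vector_reject.
(* As |sigma - lam| <= g / 2, the shift term is absorbed on the left; half of the gap survives,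
   whence 2 / g. *)
have b'le : vnorm b' <= 2 / g * (normc gam * (s * vnorm u)).
  have : g * vnorm b' <= normc gam * (s * vnorm u) + g / 2 * vnorm b'.
    apply: le_trans (gw _ xb') _; rewrite res.
    apply: le_trans (vnormD_le _ _) _; rewrite !vnormZ bnorm lerD2l.
    by rewrite ler_wpM2r ?vnorm_ge0.
  set K := normc gam * _ => h; rewrite -(ler_pM2l g0).
  have -> : g * (2 / g * K) = 2 * K by field; rewrite gt_eqF.
  lra.
(* A sine of at most 1/2 leaves |a|^2 >= (3/4) |u|^2, more than enough; this trades the tangent for
   the sine at the cost of a factor 2. *)
have a2 : vnorm u / 2 <= normc a.
  have uE := sinangle_vectorE x1 u0; rewrite -/s -/a exprMn in uE.
  rewrite -ler_sqr ?nnegrE ?divr_ge0 ?vnorm_ge0 ?normc_ge0 //.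
  have s4 : s ^+ 2 <= 4^-1.
    have -> : 4^-1 = 2^-1 ^+ 2 :> R by field.
    by rewrite ler_sqr ?nnegrE ?sinangle_ge0 ?invr_ge0.
  have := ler_wpM2r (sqr_ge0 (vnorm u)) s4; rewrite expr_div_n uE.
  have := sqr_ge0 (vnorm u); lra.
have ugt : 0 < vnorm u by rewrite vnorm_gt0.
have agt : 0 < normc a by apply: lt_le_trans a2; rewrite divr_gt0.
have ls : lam - sigma != 0 by rewrite subr_eq0 eq_sym.
(* Were [gam] zero, both components of [v] would vanish. *)
have gam0 : gam != 0.
  apply: contra_neq v0 => g00.
  have a'0 : a' = 0.
    by apply/eqP; move/eqP: coef; rewrite g00 mul0r mulf_eq0 (negPf ls).
  have := b'le; rewrite g00 normc0 mul0r mulr0 /b' a'0 scale0r subr0 => v0.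
  by apply/eqP; rewrite -vnorm_eq0 eq_le v0 vnorm_ge0.
have a'0 : a' != 0.
  apply: contraTneq agt => a'0; move: coef; rewrite a'0 mulr0 => /esym/eqP.
  by rewrite mulf_eq0 (negPf gam0) /= => /eqP->; rewrite normc0 ltxx.
(* This scaling gives [v] the component [x] along [x], so that only the transverse part remains in
   the difference. *)
exists a'^-1.
have -> : x - a'^-1 *: v = (- a'^-1) *: b'.
  by rewrite scalerBr scalerA mulNr mulVf // scaleNr scaleN1r opprK addrC.
rewrite vnormZ normcN normcV.
have gamgt : 0 < normc gam by rewrite normc_gt0.
have dgt : 0 < d by rewrite normc_gt0 subr_eq0.
have na' : normc a' = normc gam * normc a / d.
  apply: (mulIf (lt0r_neq0 dgt)); rewrite divfK ?gt_eqF // -normcM -coef.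
  by rewrite normcM normc_subC mulrC.
rewrite na' mulrC ler_pdivrMr ?divr_gt0 ?mulr_gt0 //.
apply: le_trans b'le _.
have -> : 4 / g * d * s * (normc gam * normc a / d)
    = 2 / g * (normc gam * (s * (2 * normc a))).
  by field; rewrite !gt_eqF.
have s0 : 0 <= s by exact: sinangle_ge0.
rewrite ler_wpM2l ?divr_ge0 ?(ltW g0) // ler_wpM2l ?(ltW gamgt) //.
by rewrite ler_wpM2l //; lra.
Qed.

Lemma eigen_residual n (A : 'M[C]_n) (lam : C) (x u : 'cV[C]_n) :
  A *m x = lam *: x ->
  (A - lam%:M) *m u = (A - lam%:M) *m (u - dotc x u *: x).
Proof.
move=> Ax; rewrite mulmxBr -[in X in _ = _ - X]scalemxAr.
by rewrite [X in _ *: X]mulmxBl mul_scalar_mx Ax subrr scaler0 subr0.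
Qed.

Lemma eigen_residual_le n (A : 'M[C]_n) (lam : C) (x u : 'cV[C]_n) :
  A *m x = lam *: x -> vnorm x = 1 -> u != 0 ->
  vnorm ((A - lam%:M) *m u) <= specnorm (A - lam%:M) * (sinangle x u * vnorm u).
Proof.
move=> Ax x1 u0; rewrite (eigen_residual _ Ax) -sinangle_vector_reject //.
exact: le_specnorm.
Qed.

(* As A is normal, (A - lam) maps the complement of x into itself, so only the
   component of u orthogonal to x contributes, on both sides. *)
Lemma eigen_quadratic_le n (A : 'M[C]_n) (lam : C) (x u : 'cV[C]_n) :
  A \is normalmx -> A *m x = lam *: x -> vnorm x = 1 -> u != 0 ->
  normc (dotc u ((A - lam%:M) *m u))
    <= specnorm (A - lam%:M) * (sinangle x u * vnorm u) ^+ 2.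
Proof.
move=> An Ax x1 u0; set b := u - dotc x u *: x.
have xx : dotc x x = 1 by rewrite dotcc x1 expr1n.
have xb : dotc x b = 0 by rewrite dotcBr dotcZr xx mulr1 subrr.
have xBb : dotc x ((A - lam%:M) *m b) = 0.
  rewrite mulmxBl mul_scalar_mx dotcBr dotcZr (eigenvector_dotc An Ax) xb.
  by rewrite mulr0 subrr.
have -> : dotc u ((A - lam%:M) *m u) = dotc b ((A - lam%:M) *m b).
  rewrite (eigen_residual _ Ax) -/b -[in LHS](subrK (dotc x u *: x) u) -/b.
  by rewrite dotcDl dotcZl xBb mulr0 addr0.
rewrite -sinangle_vector_reject // -/b.
apply: le_trans (dotc_le _ _) _; rewrite expr2 mulrA mulrC.
by rewrite ler_wpM2r ?vnorm_ge0 ?le_specnorm.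
Qed.

Lemma rayleigh_error n (A : 'M[C]_n) (lam : C) (x u : 'cV[C]_n) :
  A \is normalmx -> A *m x = lam *: x -> vnorm x = 1 -> u != 0 ->
  normc (rayleigh A u - lam) <= specnorm (A - lam%:M) * sinangle x u ^+ 2.
Proof.
move=> An Ax x1 u0; have uu : dotc u u != 0 by rewrite dotcc_eq0.
have un : 0 < vnorm u by rewrite vnorm_gt0.
have -> : rayleigh A u - lam = dotc u ((A - lam%:M) *m u) / dotc u u.
  rewrite /rayleigh -mulmxA -/(dotc u (A *m u)) -/(dotc u u).
  by rewrite mulmxBl mul_scalar_mx dotcBr dotcZr mulrBl mulfK.
rewrite normcM normcV dotcc normc_real ?sqr_ge0 //.
rewrite ler_pdivrMr ?exprn_gt0 // -mulrA -exprMn.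
exact: eigen_quadratic_le.
Qed.

End InverseIteration.

(** * Sketching *)

Section Sketch.
Variable R : realType.
Local Notation C := R[i].

Lemma vnorm_parallelogram n (p q : 'cV[C]_n) :
  vnorm (p + q) ^+ 2 + vnorm (p - q) ^+ 2
  = 2 * (vnorm p ^+ 2 + vnorm q ^+ 2).
Proof.
apply: complexI.
rewrite realcM rmorph_nat !rmorphD /= -!dotcc.
by rewrite !(dotcDl, dotcDr, dotcNl, dotcNr); ring.
Qed.

Lemma vnorm_polarization n (p q : 'cV[C]_n) :
  (vnorm (p + q) ^+ 2 - vnorm (p - q) ^+ 2)%:C
  = 2 * (dotc p q + (dotc p q)^*).
Proof.
rewrite rmorphB /= -!dotcc -dotcC.
by rewrite !(dotcDl, dotcDr, dotcNl, dotcNr); ring.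
Qed.

(* Rotating and rescaling u and w makes the Hermitian form S^*S - I real on the
   pair with both vectors of norm |u||w|; polarization then bounds it. *)
Lemma embedding_dotc s n (S : 'M[C]_(s, n)) (eps : R) U (u w : 'cV[C]_n) :
  0 <= eps -> subspace_embedding eps S U ->
  (forall a b : C, U (a *: u + b *: w)) ->
  normc (dotc (S *m u) (S *m w) - dotc u w) <= eps * (vnorm u * vnorm w).
Proof.
move=> eps0 emb Uuw; set z := _ - _.
have [uw0|uw0] := eqVneq (vnorm u * vnorm w) 0.
  suff -> : z = 0 by rewrite normc0 uw0 mulr0.
  move/eqP: uw0; rewrite mulf_eq0 !vnorm_eq0 /z => /orP[] /eqP ->.
    by rewrite mulmx0 !dotc0l subrr.
  by rewrite mulmx0 !dotc0r subrr.
have [z0|z0] := eqVneq z 0.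
  by rewrite z0 normc0 !mulr_ge0 ?vnorm_ge0.
have uwgt : 0 < vnorm u * vnorm w.
  by rewrite lt_neqAle eq_sym uw0 mulr_ge0 ?vnorm_ge0.
set N := vnorm u * vnorm w in uwgt *.
pose om := z / `|z|.
have om1 : normc om = 1.
  apply: complexI; rewrite -normcE_norm normrM normfV normr_id.
  by rewrite mulfV // normr_eq0.
have omz : om^* * z = (normc z)%:C.
  have nz : `|z|^* = `|z| by apply/CrealP; exact: normr_real.
  rewrite /om rmorphM /= fmorphV /= nz mulrAC.
  by rewrite -normCKC expr2 mulfK ?normr_eq0.
pose p := ((vnorm w)%:C * om) *: u; pose q := (vnorm u)%:C *: w.
have pn : vnorm p = N.
  by rewrite vnormZ normcM om1 mulr1 normc_real ?vnorm_ge0 // mulrC.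
have qn : vnorm q = N by rewrite vnormZ normc_real ?vnorm_ge0.
have form : dotc (S *m p) (S *m q) - dotc p q = (N * normc z)%:C.
  rewrite /p /q -!scalemxAr !dotcZl !dotcZr -!mulrBr -/z rmorphM /= conjC_realc.
  by rewrite /N !realcM -omz; ring.
have diff : vnorm (S *m (p + q)) ^+ 2 - vnorm (S *m (p - q)) ^+ 2
   - (vnorm (p + q) ^+ 2 - vnorm (p - q) ^+ 2) = 4 * (N * normc z).
  apply: complexI; rewrite rmorphB /= mulmxDr mulmxBr !vnorm_polarization.
  rewrite -mulrBr opprD addrACA -rmorphB form /= conjC_realc.
  by rewrite (realcM 4) rmorph_nat; ring.
have [_ Spq] : (1 - eps) * vnorm (p + q) ^+ 2 <= vnorm (S *m (p + q)) ^+ 2 /\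
    vnorm (S *m (p + q)) ^+ 2 <= (1 + eps) * vnorm (p + q) ^+ 2.
  by apply: emb; exact: Uuw.
have [Smq _] : (1 - eps) * vnorm (p - q) ^+ 2 <= vnorm (S *m (p - q)) ^+ 2 /\
    vnorm (S *m (p - q)) ^+ 2 <= (1 + eps) * vnorm (p - q) ^+ 2.
  by apply: emb; rewrite /p /q -scaleNr; exact: Uuw.
(* Since |p| = |q| = N, the sum of the two squared norms is 4 N^2, and the factor 4 N cancels
   against the left-hand side. *)
have := vnorm_parallelogram p q; rewrite pn qn => par.
rewrite -(ler_pM2l uwgt).
have : 4 * (N * normc z)
    <= eps * (vnorm (p + q) ^+ 2 + vnorm (p - q) ^+ 2).
  by rewrite -diff; lra.
by rewrite par; lra.
Qed.

Lemma PiSE s n (S : 'M[C]_(s, n)) (u z : 'cV[C]_n) :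
  PiS S u *m z = z - dotc (S *m u) (S *m z) *: u.
Proof.
by rewrite mulmxBl mul1mx -!mulmxA mx11_dotc mul_mx_scalar.
Qed.

(** The projector fixes [t] and otherwise only subtracts multiples of [u], so the correction
    equation places (A - sigma)(u + t) on the line of [u]. The sum [u + t] is nonzero because its
    sketched product with [u] is 1. *)
Lemma correction_span s n (S : 'M[C]_(s, n)) (A : 'M[C]_n) (sigma : C)
    (u t : 'cV[C]_n) :
  vnorm (S *m u) = 1 -> correction_equation S A sigma u t ->
  (exists gam, (A - sigma%:M) *m (u + t) = gam *: u) /\ u + t != 0.
Proof.
move=> Su1 [eq_t tu].
have ut0 : dotc (S *m u) (S *m t) = 0.
  by rewrite dotcC /dotc tu mxE rmorph0.
split; last first.
  apply/eqP => /(congr1 (fun z => dotc (S *m u) (S *m z))).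
  rewrite mulmxDr dotcDr ut0 dotcc Su1 expr1n addr0 mulmx0 dotc0r => /eqP.
  by rewrite oner_eq0.
move: eq_t; rewrite -mulmxA (PiSE _ _ t) ut0 scale0r subr0 -mulmxA !PiSE.
set a := dotc _ _; set b := dotc _ _ => /eqP.
rewrite -addr_eq0 => /eqP eq0; exists (a + b).
have rE : residual A sigma u = (A - sigma%:M) *m u.
  by rewrite mulmxBl mul_scalar_mx.
rewrite mulmxDr -rE scalerDl; apply/eqP; rewrite -subr_eq0.
by rewrite [residual _ _ _ + _]addrC opprD addrACA eq0.
Qed.

(** Cauchy-Schwarz for [z] and N N^* z, the latter having the norm of N^* z because [N] is an
    isometry. *)
Lemma vnorm_adjoint_le m n (N : 'M[C]_(m, n)) (z : 'cV[C]_m) :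
  N^t* *m N = 1%:M -> vnorm (N^t* *m z) <= vnorm z.
Proof.
move=> NN; have [->|z0] := eqVneq (vnorm (N^t* *m z)) 0; first exact: vnorm_ge0.
have pz : 0 < vnorm (N^t* *m z) by rewrite lt_neqAle eq_sym z0 vnorm_ge0.
rewrite -(ler_pM2r pz) -expr2.
rewrite mulrC -[X in _ <= X * _](vnorm_isometry _ NN).
apply: le_trans (dotc_le _ _).
by rewrite dotc_mulmx dotcc normc_real ?sqr_ge0.
Qed.

(* Gram-Schmidt normalises the scalar product of each row with its image to be
   nonnegative, so the unit vector y^* is its own image. *)
Lemma unitary_completion k (y : 'cV[C]_k) : vnorm y = 1 ->
  exists Y : 'M[C]_(k, k.-1), row_mx y Y \is unitarymx.
Proof.
case: k y => [|k] y y1.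
  by have := oner_neq0 R; rewrite -y1 (flatmx0 y) vnorm0 eqxx.
pose B : 'M[C]_(1 + k) := col_mx (y^t*) 0.
pose Q := schmidt B; pose i0 : 'I_(1 + k) := lshift k 0.
have Qu : Q \is unitarymx by exact: schmidt_unitarymx.
have B0 : row i0 B = y^t*.
  by rewrite rowKu; apply/rowP => j; rewrite !mxE.
pose q : 'rV[C]_(1 + k) := row i0 Q.
have qq : q *m q^t* = 1%:M.
  have /row_unitarymxP/(_ i0 i0) := Qu; rewrite dotmxE eqxx -/q => qq.
  by rewrite [LHS]mx11_scalar qq.
have [a aE] : exists a, y^t* = a *: q.
  have := row_schmidt_sub B i0; rewrite B0 (big_pred1 i0) => [|j].
    by rewrite genmxE => /sub_rVP.
  by rewrite leqn0.
have a0 : 0 <= a.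
  have := form1_row_schmidt B i0; rewrite B0 dotmxE -/Q -/q.
  by rewrite aE -scalemxAl qq !mxE mulr1.
have aa : a * a^* = 1.
  have : y^t* *m (y^t*)^t* = 1%:M.
    by rewrite trmxCK mx11_dotc dotcc y1 expr1n.
  rewrite aE trmxCZ -scalemxAl -scalemxAr qq scalerA => /matrixP/(_ 0 0).
  by rewrite !mxE mulr1.
have a1 : a = 1.
  have := normCK a; rewrite aa ger0_norm // => /eqP.
  by rewrite pexpr_eq1 // => /eqP.
rewrite a1 scale1r in aE.
exists ((dsubmx Q)^t*).
have -> : row_mx y ((dsubmx Q)^t*) = Q^t*.
  rewrite -[Q in RHS]vsubmxK tr_col_mx map_row_mx; congr row_mx.
  rewrite -[y]trmxCK aE; congr (_^t*); apply/rowP => j; rewrite !mxE.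
  congr (Q _ _); exact: val_inj.
by rewrite trmxC_unitary.
Qed.

(** The columns of [V] need not be orthonormal before sketching, but [S *m V] is injective, hence so
    is [V]. This makes the Euclidean projection onto its column space available. *)
Lemma sketch_gram_unit s n k (S : 'M[C]_(s, n)) (V : 'M[C]_(n, k)) :
  sketch_orthonormal S V -> V^t* *m V \in unitmx.
Proof.
move=> SV; rewrite -row_free_unit; apply/inj_row_free => v vV.
have : V^t* *m V *m v^t* = 0.
  have := congr1 (fun M => M^t*) vV.
  by rewrite !trmxCM trmxCK trmx0 map_mx0.
rewrite -mulmxA => {}vV.
have /eqP Vv : V *m v^t* == 0.
  by rewrite -dotcc_eq0 dotc_mulmx vV dotc0r.
have : v^t* = 0.
  by rewrite -[LHS]mul1mx -SV -!mulmxA Vv !mulmx0.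
by move/(congr1 (fun M => M^t*)); rewrite trmxCK trmx0 map_mx0.
Qed.

End Sketch.

(** * Sketched Ritz vectors under the separation condition *)

Section Ritz.
Variable R : realType.
Local Notation C := R[i].

(** Transports [mulmx1C] along an equality of dimensions, for [row_mx y Y], whose width [1 + k.-1]
    is [k] only up to a proof. *)
Lemma mulmx1C_square m n (M : 'M[C]_(m, n)) (N : 'M[C]_(n, m)) :
  m = n -> M *m N = 1%:M -> N *m M = 1%:M.
Proof. by move=> mn; case: n / mn M N => M N; exact: mulmx1C. Qed.

(** In the basis [y, Y] the matrix [H] is block triangular, so the Y-component of (H - lam) c is H22
    - lam applied to that of [c]. Taking the Y-component does not increase norms. *)
Lemma separated_le k (H : 'M[C]_k) (theta lam : C) (y c : 'cV[C]_k) (beta : R) :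
  0 <= beta -> vnorm y = 1 -> H *m y = theta *: y ->
  separated H theta y lam beta ->
  exists (a : C) (d : 'cV[C]_k), [/\ c = a *: y + d &
    beta * vnorm d <= vnorm ((H - lam%:M) *m c)].
Proof.
move=> beta0 y1 Hy sep; have [Y Qu] := unitary_completion y1.
have /unitarymxP QQ := Qu.
have k0 : k = (1 + k.-1)%N.
  case: k y y1 {H Hy sep Y Qu QQ c} => // y y1.
  by have := oner_neq0 R; rewrite -y1 (flatmx0 y) vnorm0 eqxx.
have QQ' : (row_mx y Y)^t* *m row_mx y Y = 1%:M.
  exact: mulmx1C_square.
have split_c : c = y *m (y^t* *m c) + Y *m (Y^t* *m c).
  rewrite -[LHS]mul1mx -QQ tr_row_mx map_col_mx mul_row_col mulmxDl.
  by rewrite !mulmxA.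
move: (QQ'); rewrite tr_row_mx map_col_mx mul_col_row scalar_mx_block.
move=> /eq_block_mx [yy yY Yy YY].
pose H22 := Y^t* *m H *m Y.
have /(_ _)/le_sigma_min sig := sep Y (y^t* *m H *m Y) H22 Qu.
exists (dotc y c), (Y *m (Y^t* *m c)); split.
  by rewrite {1}split_c mx11_dotc mul_mx_scalar.
rewrite vnorm_isometry //.
apply: le_trans (sig _ _ _) _ => //.
  rewrite tr_row_mx map_col_mx mul_col_mx mul_col_row.
  by congr block_mx; rewrite -mulmxA Hy -scalemxAr ?yy ?Yy ?scaler0 ?scalemx1.
have -> : (H22 - lam%:M) *m (Y^t* *m c) = Y^t* *m ((H - lam%:M) *m c).
  have : Y^t* *m (H *m c) = H22 *m (Y^t* *m c).
    rewrite {1}split_c !mulmxDr (mulmxA H) Hy -scalemxAl -scalemxAr.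
    by rewrite (mulmxA (Y^t*)) Yy mul0mx scaler0 add0r /H22 !mulmxA.
  by move=> HY; rewrite !mulmxBl !mulmxBr !mul_scalar_mx -HY scalemxAr.
exact: vnorm_adjoint_le.
Qed.

Lemma colspan_row_mx n k (A : 'M[C]_n) (V : 'M[C]_(n, k)) (y z : 'cV[C]_k) :
  colspan (row_mx V (A *m V)) (V *m y + A *m (V *m z)).
Proof.
by exists (col_mx y z) => //; rewrite mul_row_col mulmxA.
Qed.

(** The coordinates [c] of the projection of [x] form an approximate eigenvector of the projected
    matrix, with residual controlled by |e|. Separation then makes [c] nearly parallel to [y], and
    Pythagoras adds the deviation V d to [e]; these two terms are the two summands under the root in
    [CRR]. *)
Lemma ritz_sine_le s n k (S : 'M[C]_(s, n)) (A : 'M[C]_n) (V : 'M[C]_(n, k))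
    (theta lam : C) (y : 'cV[C]_k) (x : 'cV[C]_n) (eps beta : R) :
  0 < eps -> eps < 1 -> 0 < beta -> A *m x = lam *: x -> vnorm x = 1 ->
  sketch_orthonormal S V ->
  subspace_embedding eps S (colspan (row_mx V (A *m V))) ->
  sketched_proj S A V *m y = theta *: y -> vnorm y = 1 ->
  separated (sketched_proj S A V) theta y lam beta ->
  sinangle x (V *m y) <= CRR A lam eps beta * sinangle x V.
Proof.
move=> eps0 eps1 beta0 Ax x1 SV emb ritz y1 sep.
have [c xV] := ortho_projection x (sketch_gram_unit SV).
set e := x - V *m c in xV.
have rhoE : sinangle x V = vnorm e by exact: sinangle_ortho.
have [a [d [cE dle]]] := separated_le c (ltW beta0) y1 ritz sep.
set B := A - lam%:M; set nB := specnorm B.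
(* [B] kills [x], so the projection of [x] may be exchanged for its small error [e]. *)
have Be : B *m (V *m c) = - (B *m e).
  have Bx : B *m x = 0 by rewrite mulmxBl mul_scalar_mx Ax subrr.
  by rewrite /e [in RHS]mulmxBr Bx sub0r opprK.
(* The lower embedding bound supplies the denominator of [Keps]; the upper one, in [resle], supplies
   its numerator. *)
have Vle z : (1 - eps) * vnorm (V *m z) ^+ 2 <= vnorm z ^+ 2.
  rewrite -(vnorm_isometry z SV) -mulmxA.
  apply: (emb _ _).1.
  by have := colspan_row_mx A V z 0; rewrite !mulmx0 addr0.
have resle : vnorm ((sketched_proj S A V - lam%:M) *m c) ^+ 2
    <= (1 + eps) * (nB * vnorm e) ^+ 2.
  have -> : (sketched_proj S A V - lam%:M) *m c
      = (S *m V)^t* *m (S *m (B *m (V *m c))).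
    rewrite /sketched_proj /B !mulmxBl !mul_scalar_mx !mulmxBr.
    rewrite -!mulmxA -!scalemxAr; congr (_ - _ *: _).
    by rewrite -[LHS]mul1mx -SV !mulmxA.
  apply: (@le_trans _ _ (vnorm (S *m (B *m (V *m c))) ^+ 2)).
    by rewrite -vnorm_le vnorm_adjoint_le.
  apply: le_trans (_ : (1 + eps) * vnorm (B *m (V *m c)) ^+ 2 <= _).
    apply: (emb _ _).2; rewrite mulmxBl mul_scalar_mx addrC scalemxAr -scaleN1r.
    by rewrite scalemxAr; exact: colspan_row_mx.
  have nN : vnorm (- (B *m e)) = vnorm (B *m e).
    by rewrite -scaleN1r vnormZ normcN normc1 mul1r.
  rewrite Be nN; apply: ler_wpM2l; first by lra.
  rewrite ler_sqr ?nnegrE ?mulr_ge0 ?vnorm_ge0 ?specnorm_ge0 //.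
  exact: le_specnorm.
have dle2 : beta ^+ 2 * vnorm d ^+ 2 <= (1 + eps) * (nB * vnorm e) ^+ 2.
  apply: le_trans resle; rewrite -exprMn ler_sqr ?nnegrE ?vnorm_ge0 //.
  by rewrite mulr_ge0 ?vnorm_ge0 // ltW.
have xE : x - V *m y *m a%:M = V *m d + e.
  by rewrite mul_mx_scalar /e cE mulmxDr -scalemxAr opprD [RHS]addrC addrA subrK.
apply: le_trans (sinangle_le _ a%:M x1) _; rewrite rhoE.
rewrite -ler_sqr ?nnegrE ?mulr_ge0 ?sqrtr_ge0 ?vnorm_ge0 // xE.
rewrite vnormD_ortho; last by rewrite dotc_mulmx xV dotc0r.
have C0 : 0 <= 1 + Keps eps * nB ^+ 2 / beta ^+ 2.
  rewrite addr_ge0 // divr_ge0 ?sqr_ge0 // mulr_ge0 ?sqr_ge0 // divr_ge0 //; lra.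
rewrite exprMn /CRR (sqr_sqrtr C0) mulrDl mul1r addrC lerD2l.
have b2 : 0 < beta ^+ 2 by rewrite exprn_gt0.
have e1 : 0 < 1 - eps by lra.
rewrite -(ler_pM2l e1) -(ler_pM2l b2).
apply: le_trans (_ : beta ^+ 2 * vnorm d ^+ 2 <= _); first by rewrite ler_pM2l.
apply: le_trans dle2 _.
rewrite [leRHS](_ : _ = (1 + eps) * (nB * vnorm e) ^+ 2) //.
by rewrite /Keps; field; rewrite !gt_eqF.
Qed.

End Ritz.

(** * The randomized Jacobi-Davidson step *)

Section Step.
Variable R : realType.
Local Notation C := R[i].

Lemma CRR_ge1 n (A : 'M[C]_n) (lam : C) (eps beta : R) :
  0 <= eps -> eps <= 1 -> 1 <= CRR A lam eps beta.
Proof.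
move=> eps0 eps1; rewrite -[leLHS]sqrtr1 ler_wsqrtr // lerDl.
rewrite divr_ge0 ?sqr_ge0 // mulr_ge0 ?sqr_ge0 // divr_ge0 //; lra.
Qed.

(** Pairing the Ritz equation with the unit vector [y] turns theta - lam into the sketched product
    of [u] and [B *m u], which the embedding compares with the Euclidean one. *)
Lemma ritz_value_error s n k (S : 'M[C]_(s, n)) (A : 'M[C]_n) (V : 'M[C]_(n, k))
    (theta lam : C) (y : 'cV[C]_k) (x : 'cV[C]_n) (eps : R) :
  A \is normalmx -> 0 < eps -> eps < 1 -> A *m x = lam *: x -> vnorm x = 1 ->
  subspace_embedding eps S (colspan (row_mx V (A *m V))) ->
  sketched_proj S A V *m y = theta *: y -> vnorm y = 1 ->
  V *m y != 0 -> vnorm (S *m (V *m y)) = 1 ->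
  normc (theta - lam) <= specnorm (A - lam%:M) / (1 - eps)
    * (eps * sinangle x (V *m y) + sinangle x (V *m y) ^+ 2).
Proof.
move=> An eps0 eps1 Ax x1 emb ritz y1; set u := V *m y => u0 Su1.
set B := A - lam%:M; set sn := sinangle x u; set nB := specnorm B.
have yy : dotc y y = 1 by rewrite dotcc y1 expr1n.
have SuSu : dotc (S *m u) (S *m u) = 1 by rewrite dotcc Su1 expr1n.
have -> : theta - lam = dotc (S *m u) (S *m (B *m u)).
  rewrite /B mulmxBl mul_scalar_mx mulmxBr -scalemxAr dotcBr dotcZr SuSu mulr1.
  congr (_ - _); rewrite -[LHS]mulr1 -yy -dotcZr -ritz /sketched_proj.
  by rewrite -[_ *m y]mulmxA -dotc_mulmx /u !mulmxA.
have sn0 : 0 <= sn by exact: sinangle_ge0.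
have nB0 : 0 <= nB by exact: specnorm_ge0.
have un : 0 < vnorm u by rewrite vnorm_gt0.
(* Only [S *m u] has norm 1; passing back to |u| is what costs the factor 1 / (1 - eps). *)
have u2 : vnorm u ^+ 2 <= (1 - eps)^-1.
  have /emb[] : colspan (row_mx V (A *m V)) u.
    by have := colspan_row_mx A V y 0; rewrite !mulmx0 addr0.
  by rewrite Su1 expr1n => h _; rewrite -[leRHS]mul1r ler_pdivlMr 1?mulrC; lra.
have dB : normc (dotc (S *m u) (S *m (B *m u)) - dotc u (B *m u))
    <= eps * (vnorm u * vnorm (B *m u)).
  apply: embedding_dotc emb _; first exact: ltW.
  move=> a b; rewrite /B mulmxBl mul_scalar_mx scalerBr addrCA addrC -addrA.
  have := colspan_row_mx A V ((a - b * lam) *: y) (b *: y).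
  rewrite -!scalemxAr -/u; congr (colspan _ _).
  by rewrite scalerA scalerBl; apply/colP => i; rewrite !mxE; ring.
have Bu : vnorm (B *m u) <= nB * (sn * vnorm u) by exact: eigen_residual_le.
have Bq : normc (dotc u (B *m u)) <= nB * (sn * vnorm u) ^+ 2.
  exact: eigen_quadratic_le.
apply: (@le_trans _ _ (nB * (eps * sn + sn ^+ 2) * vnorm u ^+ 2)); last first.
  rewrite [leRHS]mulrAC; apply: ler_wpM2l; last exact: u2.
  by rewrite mulr_ge0 // addr_ge0 ?sqr_ge0 // mulr_ge0 // ltW.
rewrite -[X in normc X](subrK (dotc u (B *m u))).
apply: le_trans (le_normcD _ _) _.
have -> : nB * (eps * sn + sn ^+ 2) * vnorm u ^+ 2
  = eps * (vnorm u * (nB * (sn * vnorm u))) + nB * (sn * vnorm u) ^+ 2 by ring.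
apply: lerD Bq; apply: le_trans dB _.
by apply: ler_wpM2l; [exact: ltW | apply: ler_wpM2l; first exact: ltW].
Qed.

(** The inverse iterate [u + t] lies in the expanded space, so its multiples are admissible trial
    vectors for the new sine. *)
Lemma correction_sine_le s n k k' (S : 'M[C]_(s, n)) (A : 'M[C]_n)
    (V : 'M[C]_(n, k)) (V' : 'M[C]_(n, k')) (lam sigma : C) (y : 'cV[C]_k)
    (x t : 'cV[C]_n) :
  A \is normalmx -> simple_eigenvalue A lam -> 0 < gap A lam ->
  A *m x = lam *: x -> vnorm x = 1 ->
  V *m y != 0 -> vnorm (S *m (V *m y)) = 1 -> sigma <> lam ->
  correction_equation S A sigma (V *m y) t -> expands S V t V' ->
  sinangle x (V *m y) <= 2^-1 -> normc (sigma - lam) <= gap A lam / 2 ->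
  sinangle x V'
    <= 4 / gap A lam * normc (sigma - lam) * sinangle x (V *m y).
Proof.
move=> An lam1 g0 Ax x1 u0 Su1 /eqP sl corr [_ VV' _ _] s2 d2.
have x0 : x != 0 by rewrite -vnorm_eq0 x1 oner_eq0.
have [[gam eq_v] v0] := correction_span Su1 corr.
have [c cle] := shifted_solve_sine An Ax x1 g0
  (fun w => @le_gap _ _ _ _ _ An Ax lam1 x0 w) u0 v0 sl eq_v s2 d2.
have [d _ dE] : colspan V' (V *m y + t).
  rewrite VV'; exists (col_mx y 1%:M) => //.
  by rewrite mul_row_col mulmx1.
apply: le_trans (sinangle_le _ (c *: d) x1) _.
by rewrite -scalemxAr dE.
Qed.

Lemma rjd_sketch_orthonormal s n (S : 'M[C]_(s, n)) (A : 'M[C]_n) (lam : C) N k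
    (V : forall m, 'M[C]_(n, k m)) (y : forall m, 'cV[C]_(k m)) theta sigma t :
  rjd_run S A lam N V y theta sigma t ->
  forall m, (m <= N)%N -> sketch_orthonormal S (V m).
Proof.
move=> run [|m] mN; first exact: rjd_init run.
by have [] := rjd_expand run mN.
Qed.

Lemma sinangle_eq0 n k (x : 'cV[C]_n) (W : 'M[C]_(n, k)) (c : 'cV[C]_k) :
  (forall w, dotc x w = 0 -> w = 0) -> vnorm x = 1 -> W *m c != 0 ->
  sinangle x W = 0.
Proof.
move=> triv x1 Wc0; set w := W *m c in Wc0.
have xx : dotc x x = 1 by rewrite dotcc x1 expr1n.
have wE : w = dotc x w *: x.
  apply/eqP; rewrite -subr_eq0; apply/eqP/triv.
  by rewrite dotcBr dotcZr xx mulr1 subrr.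
have a0 : dotc x w != 0.
  by apply: contra_neq Wc0 => a0; rewrite wE a0 scale0r.
apply: le_anti; rewrite sinangle_ge0 andbT.
apply: le_trans (sinangle_le _ ((dotc x w)^-1 *: c) x1) _.
by rewrite -scalemxAr -/w {2}wE scalerA mulVf // scale1r subrr vnorm0.
Qed.

Lemma ritz_vector_normalized s n k (S : 'M[C]_(s, n)) (V : 'M[C]_(n, k))
    (y : 'cV[C]_k) :
  sketch_orthonormal S V -> vnorm y = 1 ->
  V *m y != 0 /\ vnorm (S *m (V *m y)) = 1.
Proof.
move=> SV y1; have Su1 : vnorm (S *m (V *m y)) = 1.
  by rewrite mulmxA vnorm_isometry.
split => //; apply: contra_eq_neq Su1 => ->.
by rewrite mulmx0 vnorm0 eq_sym oner_eq0.
Qed.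

(** The first smallness condition is the one on the angle in inverse iteration; the second brings
    either shift within half the gap of [lam]. *)
Lemma step_sine_le s n k k' (S : 'M[C]_(s, n)) (A : 'M[C]_n)
    (V : 'M[C]_(n, k)) (V' : 'M[C]_(n, k')) (lam theta sigma : C)
    (y : 'cV[C]_k) (x t : 'cV[C]_n) (eps : R) :
  A \is normalmx -> simple_eigenvalue A lam -> 0 < gap A lam ->
  0 < eps -> eps < 1 -> A *m x = lam *: x -> vnorm x = 1 ->
  sketch_orthonormal S V ->
  subspace_embedding eps S (colspan (row_mx V (A *m V))) ->
  sketched_proj S A V *m y = theta *: y -> vnorm y = 1 -> sigma <> lam ->
  correction_equation S A sigma (V *m y) t -> expands S V t V' ->
  let nB := specnorm (A - lam%:M) in
  let g := gap A lam in
  let sn := sinangle x (V *m y) in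
  sn <= 2^-1 -> 4 * (nB + 1) * sn <= g * (1 - eps) ->
  (sigma = theta -> sinangle x V'
     <= 4 * nB / ((1 - eps) * g) * (eps * sn ^+ 2 + sn ^+ 3)) /\
  (sigma = rayleigh A (V *m y) -> sinangle x V' <= 4 * nB / g * sn ^+ 3).
Proof.
move=> An lam1 g0 eps0 eps1 Ax x1 SV emb ritz y1 sl corr ext nB g sn s2 sg.
have [u0 Su1] := ritz_vector_normalized SV y1.
have nB0 : 0 <= nB by exact: specnorm_ge0.
have sn0 : 0 <= sn by exact: sinangle_ge0.
have e1 : 0 < 1 - eps by lra.
have sn1 : sn ^+ 2 <= sn by rewrite expr2 ler_piMl //; lra.
have nsn : nB * sn <= g * (1 - eps) / 4 by lra.
pose E := eps * sn + sn ^+ 2.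
have E0 : 0 <= E by rewrite addr_ge0 ?sqr_ge0 // mulr_ge0 // ltW.
have step := correction_sine_le An lam1 g0 Ax x1 u0 Su1 sl corr ext s2.
rewrite -/sn -/g in step.
split=> sE; rewrite sE in step.
  have dle : normc (theta - lam) <= nB / (1 - eps) * E.
    exact: ritz_value_error An eps0 eps1 Ax x1 emb ritz y1 u0 Su1.
  have EsN : E <= 2 * sn by rewrite /E; have : eps * sn <= 1 * sn;
    [rewrite ler_wpM2r // ltW | lra].
  have : nB / (1 - eps) * E <= g / 2.
    rewrite mulrAC ler_pdivrMr //.
    have := ler_wpM2l nB0 EsN; lra.
  move=> /(le_trans dle)/step h; apply: le_trans h _.
  have -> : 4 * nB / ((1 - eps) * g) * (eps * sn ^+ 2 + sn ^+ 3)
      = 4 / g * (nB / (1 - eps) * E) * sn.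
    by rewrite /E; field; rewrite !gt_eqF.
  by rewrite ler_wpM2r // ler_wpM2l // divr_ge0 // ltW.
have dle : normc (rayleigh A (V *m y) - lam) <= nB * sn ^+ 2.
  exact: rayleigh_error.
have : nB * sn ^+ 2 <= g / 2.
  have := ler_wpM2l nB0 sn1.
  have : g * (1 - eps) <= g by rewrite ler_piMr // ?ltW //; lra.
  lra.
move=> /(le_trans dle)/step h; apply: le_trans h _.
have -> : 4 * nB / g * sn ^+ 3 = 4 / g * (nB * sn ^+ 2) * sn.
  by field; rewrite gt_eqF.
by rewrite ler_wpM2r // ler_wpM2l // divr_ge0 // ltW.
Qed.

End Step.

Theorem mainTheorem3 (R : realType) (n : nat) (A : 'M[R[i]]_n) (lam : R[i])
    (eps beta : R)
    (A_normal : A \is normalmx)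
    (lam_simple : simple_eigenvalue A lam)
    (eps_gt0 : 0 < eps) (eps_lt1 : eps < 1) (beta_gt0 : 0 < beta) :
  exists2 delta : R, 0 < delta &
    forall (xR : 'cV[R[i]]_n) (s : nat) (S : 'M[R[i]]_(s, n)) (N : nat)
      (k : nat -> nat) (V : forall m, 'M[R[i]]_(n, k m))
      (y : forall m, 'cV[R[i]]_(k m)) (theta sigma : nat -> R[i])
      (t : nat -> 'cV[R[i]]_n),
    A *m xR = lam *: xR -> vnorm xR = 1 ->
    rjd_run S A lam N V y theta sigma t ->
    (forall m, (m <= N)%N ->
       subspace_embedding eps S (colspan (row_mx (V m) (A *m V m)))) ->
    (forall m, (m <= N)%N ->
       separated (sketched_proj S A (V m)) (theta m) (y m) lam beta) ->
    let u m := V m *m y m in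
    let rho m := sinangle xR (V m) in
    let sn m := sinangle xR (u m) in
    let nA := specnorm (A - lam%:M) in
    let g := gap A lam in
    let C := CRR A lam eps beta in
    forall m, (m < N)%N ->
      (sigma m = theta m ->
         (rho m < delta ->
            rho m.+1 <= 4 * nA * C ^+ 2 / ((1 - eps) * g)
                        * (eps * rho m ^+ 2 + C * rho m ^+ 3)) /\
         (sn m < delta ->
            sn m.+1 <= 4 * nA * C / ((1 - eps) * g)
                       * (eps * sn m ^+ 2 + sn m ^+ 3))) /\
      (sigma m = rayleigh A (u m) ->
         (rho m < delta ->
            rho m.+1 <= 4 * nA * C ^+ 3 / g * rho m ^+ 3) /\
         (sn m < delta ->
            sn m.+1 <= 4 * nA * C / g * sn m ^+ 3)).
Proof.
set nA := specnorm (A - lam%:M); set g := gap A lam.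
set C := CRR A lam eps beta.
have C1 : 1 <= C by apply: CRR_ge1; exact: ltW.
have C0 : 0 < C by lra.
have nA0 : 0 <= nA by exact: specnorm_ge0.
have e1 : 0 < 1 - eps by lra.
have g0 : 0 <= g by exact: gap_ge0.
(* If [lam] is the only eigenvalue, the gap has the default value 0 and so have the bounds, being
   quotients by it. The estimates then hold because every nonzero vector is a multiple of [xR], so
   the new sines vanish. *)
have [|] := boolP [exists i, spectral_diag A 0 i != lam]; last first.
  move=> /existsPn only; have {}only i : spectral_diag A 0 i = lam.
    by have := only i; rewrite negbK => /eqP.
  exists 1 => // xR s S N k V y theta sigma t Ax x1 run _ _ u rho sn.
  cbv zeta => m mN.
  have x0 : xR != 0 by rewrite -vnorm_eq0 x1 oner_eq0.
  have triv w := ortho_trivial A_normal Ax lam_simple x0 (w := w) only.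
  have [u0 _] := ritz_vector_normalized
    (rjd_sketch_orthonormal run mN) (rjd_unit run mN).
  have rho0 : rho m.+1 = 0 by exact: sinangle_eq0 triv x1 u0.
  have sn0 : sn m.+1 = 0.
    by apply: (sinangle_eq0 (c := 1%:M)) triv x1 _; rewrite mulmx1.
  have rhoge : 0 <= rho m by exact: sinangle_ge0.
  have snge : 0 <= sn m by exact: sinangle_ge0.
  have [[C0' e1'] eps0'] := (ltW C0, ltW e1, ltW eps_gt0).
  rewrite rho0 sn0; split=> _; split=> _;
    by rewrite !(e1', divr_ge0, mulr_ge0, addr_ge0, exprn_ge0).
move=> /existsP[i0 i0l]; have gt0 : 0 < g by exact: gap_gt0 i0l.
(* The two requirements of [step_sine_le]; the [+ 1] makes the denominator visibly positive. *)
pose d0 := Num.min 2^-1 (g * (1 - eps) / (4 * (nA + 1))).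
have nA4 : 0 < 4 * (nA + 1) by lra.
have d00 : 0 < d0 by rewrite lt_min invr_gt0 ltr0n /= divr_gt0 // mulr_gt0.
(* Division by [C] turns rho < delta into sn < d0 through sn <= C rho. As C >= 1, the same threshold
   also serves when [sn] itself is small. *)
exists (d0 / C); first exact: divr_gt0.
move=> xR s S N k V y theta sigma t Ax x1 run emb sep u rho sn.
cbv zeta => m mN.
have mN' := ltnW mN.
have ritz j : (j <= N)%N -> sn j <= C * rho j.
  move=> jN; apply: (ritz_sine_le eps_gt0 eps_lt1 beta_gt0 Ax x1
    (rjd_sketch_orthonormal run jN) (emb _ jN) (rjd_ritz run jN)
    (rjd_unit run jN) (sep _ jN)).
have step : sn m < d0 ->
    (sigma m = theta m ->
       rho m.+1 <= 4 * nA / ((1 - eps) * g) * (eps * sn m ^+ 2 + sn m ^+ 3)) /\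
    (sigma m = rayleigh A (u m) -> rho m.+1 <= 4 * nA / g * sn m ^+ 3).
  rewrite lt_min => /andP[/ltW s2 /ltW sg].
  apply: (step_sine_le A_normal lam_simple gt0 eps_gt0 eps_lt1 Ax x1
    (rjd_sketch_orthonormal run mN') (emb _ mN') (rjd_ritz run mN')
    (rjd_unit run mN') (rjd_shift run mN) (rjd_solve run mN)
    (rjd_expand run mN)) => //.
  by rewrite mulrC -ler_pdivlMr.
have rhoge : 0 <= rho m by exact: sinangle_ge0.
have snge : 0 <= sn m by exact: sinangle_ge0.
have rho_small : rho m < d0 / C -> sn m < d0.
  by rewrite ltr_pdivlMr // mulrC; exact: le_lt_trans (ritz _ mN').
have sn_small : sn m < d0 / C -> sn m < d0.
  by move=> h; apply: lt_le_trans h _; rewrite ler_pdivrMr // ler_peMr // ltW.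
have sn2 : sn m ^+ 2 <= (C * rho m) ^+ 2.
  by rewrite lerXn2r ?nnegrE ?ritz // mulr_ge0 // ltW.
have sn3 : sn m ^+ 3 <= (C * rho m) ^+ 3.
  by rewrite lerXn2r ?nnegrE ?ritz // mulr_ge0 // ltW.
(* Separation at the following step converts the bound on the new subspace into one on the new Ritz
   vector; this is the single factor [C] in the estimates for [sn]. *)
have next x : rho m.+1 <= x -> sn m.+1 <= C * x.
  by move=> h; apply: le_trans (ritz _ mN) _; rewrite ler_pM2l.
have K0 : 0 <= 4 * nA / ((1 - eps) * g).
  by rewrite divr_ge0 ?mulr_ge0 // ltW.
have L0 : 0 <= 4 * nA / g by rewrite divr_ge0 ?mulr_ge0.
split=> sE; split=> small.
- have [/(_ sE) h _] := step (rho_small small); apply: le_trans h _.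
  have -> : 4 * nA * C ^+ 2 / ((1 - eps) * g)
      * (eps * rho m ^+ 2 + C * rho m ^+ 3)
    = 4 * nA / ((1 - eps) * g) * (eps * (C * rho m) ^+ 2 + (C * rho m) ^+ 3).
    by field; rewrite !gt_eqF.
  by rewrite ler_wpM2l // lerD // ler_pM2l.
- have [/(_ sE)/next h _] := step (sn_small small).
  by rewrite [4 * nA * C]mulrC -!(mulrA C).
- have [_ /(_ sE) h] := step (rho_small small); apply: le_trans h _.
  have -> : 4 * nA * C ^+ 3 / g * rho m ^+ 3 = 4 * nA / g * (C * rho m) ^+ 3.
    by field; rewrite gt_eqF.
  by rewrite ler_wpM2l.
- have [_ /(_ sE)/next h] := step (sn_small small).
  by rewrite [4 * nA * C]mulrC -!(mulrA C).
Qed.
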